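(* Let $(\Omega,\mathcal F,\mathbb P)$ be a complete probability space, $d\ge1$, $\beta\in(0,1)$, and let $\{\mathcal F(\tilde s)\}_{\tilde s\in\mathbb N_0^d}$ satisfy (F1) and (F2). For each $i=1,\dots,d$ let $\{h_i'(t)\}_{t\in\mathbb N}$ be positive, decreasing, bounded and $\mathbf F_i$-predictable. Then for every $\tilde s\in\mathbb N_0^d$, $$\Phi'(\tilde s)=\mathbb E\Big[\int_0^\infty\big(1-\beta^{\tau(m;\tilde s)}\big)\,\mathrm dm\,\Big|\,\mathcal F(\tilde s)\Big]=(1-\beta)\,\mathbb E\Big[\sum_{t=0}^\infty\beta^tN(t;\tilde s)\,\Big|\,\mathcal F(\tilde s)\Big]\quad\text{a.s.}$$ Moreover, the essential supremum defining $\Phi'(\tilde s)$ is attained by an allocation strategy $\tilde T\in\mathcal A(\tilde s)$ if and only if $\tilde T$ satisfies the synchronization identity $$\sum_{i=1}^d\big[(T_i(t)-s_i)\wedge(\sigma_i(s_i;m)-s_i)\big]=t\wedge\tau(m;\tilde s)\qquad\forall\,t\in\mathbb N_0,\ m>0.$$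
   Context: (F1): $\mathcal F(\tilde s)\subseteq\mathcal F(\tilde r)$ for $\tilde s\le\tilde r$ (componentwise); (F2): $\mathcal F(\tilde 0)$ contains all null sets. $\tilde e_i$ is the $i$th unit vector, $\mathcal F_i(t):=\mathcal F(t\tilde e_i)$, $\mathbf F_i=\{\mathcal F_i(t)\}_{t\in\mathbb N_0}$; predictable means $h_i'(t)$ is $\mathcal F_i(t-1)$-measurable. For each $i$ (with $\beta^\infty:=0$ and $\mathcal S_i(t)$ the $\mathbf F_i$-stopping times valued in $\{t,t+1,\dots\}\cup\{\infty\}$): $V_i(t;m):=\operatorname{ess\,sup}_{\tau\in\mathcal S_i(t)}\mathbb E[\sum_{u=t}^{\tau-1}\beta^{u-t}h_i'(u+1)+m\beta^{\tau-t}\mid\mathcal F_i(t)]$, $m\ge0$; $\sigma_i(t;m):=\inf\{\theta\ge t:V_i(\theta;m)=m\}$ ($\inf\emptyset=\infty$). Further $\tau(m;\tilde s):=\sum_{i=1}^d(\sigma_i(s_i;m)-s_i)$ and $N(t;\tilde s):=\inf\{m\ge0:\tau(m;\tilde s)\le t\}$. Allocation strategy for $\tilde s$: $\mathbb N_0^d$-valued $\{\tilde T(t)\}_{t\in\mathbb N_0}$ with $\tilde T(0)=\tilde s$, $\tilde T(t+1)=\tilde T(t)+\tilde e_j$ for some $j$, and $\{\tilde T(t+1)=\tilde T(t)+\tilde e_j,\tilde T(t)=\tilde r\}\in\mathcal F(\tilde r)$ for all $j,\tilde r$; $\mathcal A(\tilde s)$ is the set of them. $\mathcal R'(\tilde T):=\sum_{i=1}^d\sum_{t=0}^\infty\beta^th_i'(T_i(t+1))(T_i(t+1)-T_i(t))$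 and $\Phi'(\tilde s):=\operatorname{ess\,sup}_{\tilde T\in\mathcal A(\tilde s)}\mathbb E[\mathcal R'(\tilde T)\mid\mathcal F(\tilde s)]$.
   Formalization: The essential suprema V_i(t;m), defined only up to null sets for each m, are taken in versions continuous in m ≥ 0, since for arbitrary versions σ_i, N and the identities can fail; the synchronization identity is understood almost surely, simultaneously for all t and m > 0. *)

(* Defs.v *)
From HB Require Import structures.
From mathcomp Require Import all_boot all_order all_algebra.
From mathcomp Require Import all_classical all_reals all_analysis measurable_realfun.
Set Implicit Arguments. Unset Strict Implicit. Unset Printing Implicit Defensive.
Import Order.TTheory GRing.Theory Num.Theory.
Import numFieldNormedType.Exports.
Local Open Scope classical_set_scope.
Local Open Scope ring_scope.

Section Defs.
Context {dT : measure_display} {Omega : measurableType dT} {R : realType}.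
Variable P : probability Omega R.

Definition emeas_wrt (G : set (set Omega)) (f : Omega -> \bar R) :=
  forall B : set (\bar R), measurable B -> G (f @^-1` B).

Definition meas_wrt (G : set (set Omega)) (f : Omega -> R) :=
  forall B : set R, measurable B -> G (f @^-1` B).

Definition cond_exp_of (G : set (set Omega)) (X Y : Omega -> \bar R) :=
  [/\ measurable_fun setT X, (forall w, (0 <= X w)%E),
      emeas_wrt G Y, (forall w, (0 <= Y w)%E) &
      forall A, G A -> (\int[P]_(w in A) Y w = \int[P]_(w in A) X w)%E].

Definition is_ess_sup (G : set (set Omega)) (Fam : set (Omega -> \bar R))
    (Z : Omega -> \bar R) :=
  [/\ emeas_wrt G Z,
      (forall X, Fam X -> {ae P, forall w, (X w <= Z w)%E}) &
      (forall Z', emeas_wrt G Z' ->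
          (forall X, Fam X -> {ae P, forall w, (X w <= Z' w)%E}) ->
          {ae P, forall w, (Z w <= Z' w)%E})].

Variable d : nat.
Variable Filt : ('I_d -> nat) -> set (set Omega).

Definition unitvec (i : 'I_d) (t : nat) : 'I_d -> nat :=
  fun j => if j == i then t else 0%N.

Definition Fi (i : 'I_d) (t : nat) : set (set Omega) := Filt (unitvec i t).

(* F_i-stopping times valued in {t, t+1, ...} u {oo}; None encodes oo *)
Definition stopping_time_from (i : 'I_d) (t : nat) (tau : Omega -> option nat) :=
  (forall w n, tau w = Some n -> (t <= n)%N) /\
  (forall n : nat, Fi i n [set w | tau w = Some n]).

Variable beta : R.
Variable h' : 'I_d -> nat -> Omega -> R.

(* sum_{u=t}^{tau-1} beta^{u-t} h'_i(u+1) + m beta^{tau-t}, beta^oo = 0 *)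
Definition payoffV (i : 'I_d) (t : nat) (m : R) (tau : Omega -> option nat)
    (w : Omega) : \bar R :=
  match tau w with
  | Some n => ((\sum_(t <= u < n) beta ^+ (u - t) * h' i u.+1 w)
               + m * beta ^+ (n - t))%:E
  | None => (\sum_(t <= u <oo) (beta ^+ (u - t) * h' i u.+1 w)%:E)%E
  end.

Definition famV (i : 'I_d) (t : nat) (m : R) : set (Omega -> \bar R) :=
  [set X | exists tau, stopping_time_from i t tau /\
                      cond_exp_of (Fi i t) (payoffV i t m tau) X].

Variable V : 'I_d -> nat -> R -> Omega -> R.

(* sigma_i(t;m) = inf{theta >= t : V_i(theta;m) = m}, inf of empty = +oo *)
Definition sigma_idx (i : 'I_d) (t : nat) (m : R) (w : Omega) : \bar R :=
  ereal_inf [set ((th%:R)%:E : \bar R) | th in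
              [set th : nat | (t <= th)%N /\ V i th m w = m]].

Definition tau_ms (m : R) (s : 'I_d -> nat) (w : Omega) : \bar R :=
  (\sum_(i < d) (sigma_idx i (s i) m w - ((s i)%:R)%:E))%E.

Definition N_ts (t : nat) (s : 'I_d -> nat) (w : Omega) : \bar R :=
  ereal_inf [set (m%:E : \bar R) | m in
              [set m : R | 0 <= m /\ (tau_ms m s w <= (t%:R)%:E)%E]].

Definition epow (x : \bar R) : R :=
  match x with
  | r%:E => beta `^ r
  | _ => 0
  end.

Definition addunit (s : 'I_d -> nat) (j : 'I_d) : 'I_d -> nat :=
  fun k => (s k + (k == j))%N.

Definition alloc_strategy (s : 'I_d -> nat) (T : nat -> Omega -> 'I_d -> nat) :=
  [/\ (forall w, T 0%N w = s),
      (forall t w, exists j, T t.+1 w = addunit (T t w) j) &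
      (forall j r t, Filt r [set w | T t.+1 w = addunit (T t w) j /\ T t w = r])].

Definition reward (T : nat -> Omega -> 'I_d -> nat) (w : Omega) : \bar R :=
  (\sum_(i < d) \sum_(t <oo)
     (beta ^+ t * h' i (T t.+1 w i) w * ((T t.+1 w i - T t w i)%N)%:R)%:E)%E.

Definition famPhi (s : 'I_d -> nat) : set (Omega -> \bar R) :=
  [set X | exists T, alloc_strategy s T /\ cond_exp_of (Filt s) (reward T) X].

Definition synchronized (s : 'I_d -> nat) (T : nat -> Omega -> 'I_d -> nat) :=
  {ae P, forall w, forall (t : nat) (m : R), 0 < m ->
     (\sum_(i < d) mine (((T t w i - s i)%N%:R)%:E)
                        (sigma_idx i (s i) m w - ((s i)%:R)%:E))%E
     = mine ((t%:R)%:E) (tau_ms m s w)}.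

End Defs.

(* Main.v *)
Require Import Defs.
From HB Require Import structures.
From mathcomp Require Import all_boot all_order all_algebra.
From mathcomp Require Import all_classical all_reals all_analysis measurable_realfun.
From mathcomp Require Import zify ring lra.
Set Implicit Arguments. Unset Strict Implicit. Unset Printing Implicit Defensive.
Import Order.TTheory GRing.Theory Num.Theory.
Import numFieldNormedType.Exports.
Local Open Scope classical_set_scope.
Local Open Scope ring_scope.

(* As the rewards decrease, retiring with m at time t is optimal exactly when
   h_i(t+1) <= (1 - beta) m; hence, almost surely and for all m at once,
   sigma_i(t; m) is the first u >= t with h_i(u+1) <= (1 - beta) m, and everything
   becomes pathwise.  Let g_t be the rewards collected by the adapted greedy
   strategy, which always engages an arm with the largest next reward.  They
   decrease in t, tau(m) is the number of those exceeding (1 - beta) m, and so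
   N(t) = g_t / (1 - beta) and both integrands of the theorem reduce to
   sum_t beta^t g_t.  The partial sums of the rewards collected by any other
   strategy are dominated by those of g, so by Abel summation its discounted reward
   is dominated too, with equality iff it collects the same sequence.  For a path
   collecting v, the left side of the synchronization identity is the number of
   u < t with v_u > (1 - beta) m, so the identity also says v = g. *)

Lemma addunit_inj (d : nat) (r : 'I_d -> nat) : injective (addunit r).
Proof.
move=> j k /(congr1 (fun f => f j)); rewrite /addunit eqxx.
by move/addnI; case: eqVneq.
Qed.

(** * Paths and greedy paths *)

Section HittingTimes.
Context {R : realType}.
Implicit Types (f : nat -> R) (c : R).

(** With [c = (1 - beta) m] this is [sigma_idx] along one path; the shift [th.+1] appears because an
    arm in position [th] pays [f th.+1] next. *)
Definition hit f (s : nat) c : \bar R :=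
  ereal_inf [set (th%:R%:E : \bar R) | th in
              [set th : nat | (s <= th)%N /\ f th.+1 <= c]].

Lemma hit_le f s c n : (s <= n)%N -> f n.+1 <= c -> (hit f s c <= n%:R%:E)%E.
Proof. by move=> sn fn; apply: ge_ereal_inf; exists n%:R%:E => //; exists n. Qed.

(** As [f] decreases from index 1 on, the rewards above [c] met from [s] onwards form one stretch
    ending at the hitting time; both sides measure its part before [n]. *)
Lemma mine_hit f s c n :
  (forall u, f u.+2 <= f u.+1) -> (s <= n)%N ->
  mine ((n - s)%N%:R%:E) (hit f s c - s%:R%:E)%E =
  ((\sum_(s <= u < n) (c < f u.+1)%R)%N%:R%:E : \bar R).
Proof.
move=> fdec sn.
have fle u v : (u <= v)%N -> f v.+1 <= f u.+1.
  move=> /subnK <-; elim: (v - u)%N => // k IH.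
  by rewrite addSn (le_trans (fdec _)).
have [[k [sk fk]]|nok] := pselect (exists k, (s <= k)%N /\ f k.+1 <= c); last first.
  have big k : (s <= k)%N -> c < f k.+1.
    by move=> sk; rewrite ltNge; apply/negP => fk; apply: nok; exists k.
  rewrite /hit (_ : [set _ | _ in _] = set0); last first.
    by apply/seteqP; split=> // x [k [sk fk] _]; apply: nok; exists k.
  rewrite ereal_inf0 /= min_l ?leey//.
  rewrite (eq_big_nat _ _ (F2 := fun=> 1%N)); last first.
    by move=> u /andP[su _]; rewrite big.
  by rewrite sum_nat_const_nat muln1.
have ex : exists k, (s <= k)%N && (f k.+1 <= c) by exists k; rewrite sk.
have [k0 [sk0 fk0 k0min]] : exists k0, [/\ (s <= k0)%N, f k0.+1 <= c &
    forall j, (s <= j)%N && (f j.+1 <= c) -> (k0 <= j)%N].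
  by case: (ex_minnP ex) => k0 /andP[? ?] ?; exists k0.
have hitE : hit f s c = k0%:R%:E.
  apply/eqP; rewrite eq_le hit_le//=; apply: le_ereal_inf_tmp => _ [j [sj fj] <-].
  by rewrite lee_fin ler_nat k0min// sj.
have cnt : (\sum_(s <= u < n) (c < f u.+1)%R)%N = (minn n k0 - s)%N.
  have [nk|kn] := leqP n k0.
    rewrite (eq_big_nat _ _ (F2 := fun=> 1%N)) ?sum_nat_const_nat ?muln1//.
    move=> u /andP[su un]; rewrite ltNge; case: leP => // fu.
    by have := k0min u; rewrite su fu leqNgt (leq_trans un nk) => /(_ isT).
  rewrite (big_cat_nat sk0 (ltnW kn)) /=.
  rewrite (eq_big_nat _ _ (F2 := fun=> 1%N)) ?sum_nat_const_nat ?muln1//; last first.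
    move=> u /andP[su un]; rewrite ltNge; case: leP => // fu.
    by have := k0min u; rewrite su fu leqNgt un => /(_ isT).
  rewrite big_nat_cond big1 ?addn0// => u /andP[/andP[k0u _] _].
  by rewrite ltNge (le_trans (fle _ _ k0u) fk0).
rewrite cnt hitE -EFinB -natrB// -EFin_min; congr (_%:E).
by rewrite -natr_min minEnat; congr (_%:R); lia.
Qed.

End HittingTimes.

Section Paths.
Context {R : realType} {d : nat}.
Implicit Types (T G : nat -> 'I_d -> nat) (h : 'I_d -> nat -> R) (c : R).

Definition is_path (s : 'I_d -> nat) T :=
  T 0%N = s /\ forall t, exists j, T t.+1 = addunit (T t) j.

Definition greedy h T := forall t j, T t.+1 = addunit (T t) j ->
  forall i, h i (T t i).+1 <= h j (T t j).+1.

(** Along a path exactly one increment is nonzero; summing over the arms keeps the shape of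
    [reward]. *)
Definition pulled h T t : R :=
  \sum_(i < d) h i (T t.+1 i) * (T t.+1 i - T t i)%N%:R.

Lemma pulledE h T t j : T t.+1 = addunit (T t) j ->
  pulled h T t = h j (T t j).+1.
Proof.
move=> Tj; rewrite /pulled (bigD1 j)//= Tj /addunit eqxx addn1 subSnn mulr1.
rewrite big1 ?addr0// => i /negPf ij.
by rewrite ij addn0 subnn mulr0.
Qed.

Lemma path_ge s T : is_path s T -> forall t i, (s i <= T t i)%N.
Proof.
move=> [T0 TS]; elim=> [|t IH] i; first by rewrite T0.
by have [j ->] := TS t; rewrite (leq_trans (IH i)) ?leq_addr.
Qed.

(** Regrouping by arms: by time [t] arm [i] has paid each reward with index from [s i + 1] to
    [T t i] exactly once. A general [phi] serves both for counting and for sums of shifted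
    rewards. *)
Lemma sum_pulled (M : nmodType) (phi : R -> M) s T h t : is_path s T ->
  \sum_(u < t) phi (pulled h T u) =
  \sum_(i < d) \sum_(s i <= u < T t i) phi (h i u.+1).
Proof.
move=> Tp; elim: t => [|t IH].
  by rewrite big_ord0 (proj1 Tp) big1// => i _; rewrite big_geq.
rewrite big_ord_recr /= IH; have [j Tj] := proj2 Tp t.
rewrite (pulledE h Tj) Tj (bigD1 j)//= [RHS](bigD1 j)//=.
rewrite [addunit _ _ j]/addunit eqxx addn1 big_nat_recr ?(path_ge Tp)//= -!addrA.
congr (_ + _).
rewrite addrC; congr (_ + _); apply: eq_bigr => i /negPf ij.
by rewrite /addunit ij addn0.
Qed.

Section Decreasing.
Variables (h : 'I_d -> nat -> R) (s : 'I_d -> nat).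
Hypothesis hdec : forall i u, h i u.+2 <= h i u.+1.

Let hle i u v : (u <= v)%N -> h i v.+1 <= h i u.+1.
Proof.
move=> /subnK <-; elim: (v - u)%N => // k IH.
by rewrite addSn (le_trans (hdec _ _)).
Qed.

(* The tau(m; s) of the context, for c = (1 - beta) m. *)
Definition htau c : \bar R := (\sum_(i < d) (hit (h i) (s i) c - (s i)%:R%:E))%E.

Lemma sum_mine_hit T t c : is_path s T ->
  (\sum_(i < d) mine ((T t i - s i)%N%:R%:E) (hit (h i) (s i) c - (s i)%:R%:E))%E =
  ((\sum_(u < t) (c < pulled h T u)%R)%N%:R%:E : \bar R).
Proof.
move=> Tp; rewrite (sum_pulled (fun x => nat_of_bool (c < x)) h t Tp).
rewrite (raddf_sum (GRing.natmul 1 : {additive nat -> R})).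
rewrite -sumEFin; apply: eq_bigr => i _.
by rewrite mine_hit// (path_ge Tp).
Qed.

Section Greedy.
Variable G : nat -> 'I_d -> nat.
Hypotheses (Gp : is_path s G) (Gg : greedy h G).

(** All that arm [i] can still pay is at most its next reward, which the greedy choice dominates. *)
Lemma greedy_max t i u : (G t i <= u)%N -> h i u.+1 <= pulled h G t.
Proof.
have [j Gj] := proj2 Gp t => Gu; rewrite (pulledE h Gj).
exact: le_trans (hle _ Gu) (Gg Gj i).
Qed.

Lemma greedy_decr t : pulled h G t.+1 <= pulled h G t.
Proof.
have [j Gj] := proj2 Gp t.+1; rewrite (pulledE h Gj); apply: greedy_max.
by have [k ->] := proj2 Gp t; rewrite leq_addr.
Qed.

Lemma greedy_le t u : (t <= u)%N -> pulled h G u <= pulled h G t.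
Proof.
move=> /subnK <-; elim: (u - t)%N => // k IH.
by rewrite addSn (le_trans (greedy_decr _)).
Qed.

(** A reward already collected was the greedy pull at some earlier time, and greedy pulls
    decrease. *)
Lemma greedy_min t i u : (s i <= u < G t i)%N -> pulled h G t <= h i u.+1.
Proof.
elim: t => [|t IH]; first by rewrite (proj1 Gp) => /andP[su]; rewrite ltnNge su.
have [j Gj] := proj2 Gp t; case/andP=> su uG.
have [ut|tu] := ltnP u (G t i).
  by rewrite (le_trans (greedy_decr _)) ?IH// su.
apply: le_trans (greedy_decr _) _; rewrite (pulledE h Gj).
move: uG; rewrite Gj /addunit; have [->|_] := eqVneq i j.
  by rewrite addn1 ltnS => uG; apply: hle.
by rewrite addn0 ltnNge tu.
Qed.

(* With c the value of the greedy pull at time t, the greedy path has collected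
   by time t only rewards >= c and has left only rewards <= c; as all paths
   have made t pulls by then, one may compare sums of rewards minus c. *)
Lemma greedy_opt T t : is_path s T ->
  \sum_(u < t) pulled h T u <= \sum_(u < t) pulled h G u.
Proof.
move=> Tp; set c := pulled h G t.
suff: \sum_(u < t) (pulled h T u - c) <= \sum_(u < t) (pulled h G u - c).
  by rewrite !sumrB lerD2r.
rewrite (sum_pulled (fun x => x - c) h t Tp) (sum_pulled (fun x => x - c) h t Gp).
apply: ler_sum => i _; have [TG|GT] := leqP (T t i) (G t i).
  rewrite [leRHS](big_cat_nat (path_ge Tp _ _) TG) /= lerDl.
  rewrite big_nat_cond sumr_ge0// => u /andP[/andP[Tu uG] _].
  by rewrite subr_ge0 greedy_min// (leq_trans (path_ge Tp t i) Tu).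
rewrite [leLHS](big_cat_nat (path_ge Gp _ _) (ltnW GT)) /= gerDl.
rewrite big_nat_cond sumr_le0// => u /andP[/andP[Gu uT] _].
by rewrite subr_le0 greedy_max.
Qed.

Lemma sum_pulled_le_htau T t c : is_path s T ->
  ((\sum_(u < t) (c < pulled h T u)%R)%N%:R%:E <= htau c)%E.
Proof.
move=> Tp; rewrite -(sum_mine_hit t c Tp); apply: lee_sum => i _.
by rewrite ge_min lexx orbT.
Qed.

(** Once the greedy pull is at most [c], so is the next reward of every arm; each arm has then
    reached its hitting time, which decides every minimum. *)
Lemma greedy_exhaust t c : pulled h G t <= c ->
  ((\sum_(u < t) (c < pulled h G u)%R)%N%:R%:E = htau c)%E.
Proof.
move=> gc; rewrite -(sum_mine_hit t c Gp); apply: eq_bigr => i _.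
rewrite min_r// natrB ?(path_ge Gp)// EFinB leeB//.
by apply: hit_le; rewrite ?(path_ge Gp)// (le_trans _ gc)// greedy_max.
Qed.

(** Either the pull at [t] is at most [c] and all rewards above [c] are already collected, or the
    first [t] pulls all exceed [c]. *)
Lemma greedy_sync t c :
  ((\sum_(u < t) (c < pulled h G u)%R)%N%:R%:E = mine (t%:R%:E) (htau c))%E.
Proof.
have Kt (v : nat) : (\sum_(u < v) (c < pulled h G u)%R <= v)%N.
  by rewrite -[leqRHS]card_ord -sum1_card leq_sum// => u _; case: (_ < _).
apply/eqP; rewrite eq_le le_min sum_pulled_le_htau// andbT lee_fin ler_nat Kt /=.
rewrite ge_min; have [gc|cg] := leP (pulled h G t) c.
  by rewrite (greedy_exhaust gc) lexx orbT.
rewrite lee_fin ler_nat -[leqLHS]card_ord -sum1_card leq_sum// => u _.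
by rewrite (lt_le_trans cg)// greedy_le// ltnW.
Qed.

(** Makes [htau] the generalized inverse of the greedy sequence; the formula for [N_ts] is read off
    from it. *)
Lemma htau_le t c : (htau c <= t%:R%:E)%E = (pulled h G t <= c).
Proof.
apply/idP/idP => [tau_t|gc]; last first.
  rewrite -(greedy_exhaust gc) lee_fin ler_nat.
  by rewrite -[leqRHS]card_ord -sum1_card leq_sum// => u _; case: (_ < _).
rewrite leNgt; apply/negP => cg.
(* If the pull at [t] exceeds [c], so do the first [t.+1] pulls, and [htau c] is at least [t.+1]. *)
have := greedy_sync t.+1 c; rewrite (eq_bigr (fun=> 1%N)); last first.
  by move=> u _; rewrite (lt_le_trans cg)// greedy_le// -ltnS.
rewrite sum1_card card_ord => /esym /min_idPl/le_trans/(_ tau_t).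
by rewrite lee_fin ler_nat ltnn.
Qed.

Lemma htau_lt t c : (t%:R%:E < htau c)%E = (c < pulled h G t).
Proof. by rewrite ltNge htau_le -ltNge. Qed.

Lemma htau_cases c :
  (exists2 n, htau c = n%:R%:E & forall t, (c < pulled h G t) = (t < n)%N) \/
  (htau c = +oo%E /\ forall t, c < pulled h G t).
Proof.
have [cg|] := pselect (forall t, c < pulled h G t).
  right; split=> //; apply/eqP; rewrite eq_le leey leNgt; apply/negP => tau_lt.
  have tau_ge0 : (0 <= htau c)%E.
    by rewrite (le_trans _ (sum_pulled_le_htau 0 c Gp))// big_ord0.
  have tau_fin : htau c \is a fin_num by rewrite ge0_fin_numE.
  (* Were [htau c] finite, an integer beyond it would contradict [htau_lt]. *)
  have := cg (Num.truncn (fine (htau c))).+1.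
  rewrite -htau_lt -[X in (_ < X)%E](fineK tau_fin) lte_fin.
  by rewrite ltNge ltW// truncnS_gt.
move=> /existsNP[t /negP]; rewrite -leNgt => gt; left.
have tau_fin := greedy_exhaust gt; rewrite -tau_fin.
eexists; first by [].
by move=> u; rewrite -htau_lt -tau_fin lte_fin ltr_nat.
Qed.

(** Counts above positive thresholds determine a sequence of positive rewards. *)
Lemma sync_pulled T : is_path s T -> (forall t, 0 < pulled h T t) ->
  (forall t, 0 < pulled h G t) ->
  (forall t c, 0 < c ->
    (\sum_(i < d) mine ((T t i - s i)%N%:R%:E)
                       (hit (h i) (s i) c - (s i)%:R%:E))%E
     = mine (t%:R%:E) (htau c)) <->
  (forall t, pulled h T t = pulled h G t).
Proof.
move=> Tp T0 G0; split=> [sync t|TG t c c0]; last first.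
  rewrite sum_mine_hit// -greedy_sync; congr ((_)%:R%:E).
  by apply: eq_bigr => u _; rewrite TG.
have KE v c : 0 < c -> (\sum_(u < v) (c < pulled h T u)%R =
                        \sum_(u < v) (c < pulled h G u)%R)%N.
  move=> c0; have := sync v c c0; rewrite sum_mine_hit// -greedy_sync.
  by move=> [/eqP]; rewrite eqr_nat => /eqP.
(* The difference of the counts at [t.+1] and [t] isolates the pull at [t]. *)
have E c : 0 < c -> (c < pulled h T t) = (c < pulled h G t).
  move=> c0; have := KE t.+1 c c0; rewrite !big_ord_recr /= KE// => /addnI.
  by case: (_ < _); case: (_ < _).
(* If the two pulls differed, the smaller one, taken as threshold, would separate them. *)
apply/eqP; rewrite eq_le !leNgt; apply/andP; split; apply/negP => lt.
  by move: (E _ (G0 t)); rewrite ltxx lt.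
by move: (E _ (T0 t)); rewrite ltxx lt.
Qed.

End Greedy.
End Decreasing.
End Paths.

(** * Discounted rewards *)

Section Discounting.
Context {R : realType}.
Variable beta : R.
Hypotheses (hb0 : 0 < beta) (hb1 : beta < 1).
Implicit Types (v g x : nat -> R).

Definition discounted v : \bar R := (\sum_(t <oo) (beta ^+ t * v t)%:E)%E.

Lemma discounted_ge0 v : (forall t, 0 <= v t) -> (0 <= discounted v)%E.
Proof.
move=> v0; apply: nneseries_ge0 => t _ _.
by rewrite lee_fin mulr_ge0// exprn_ge0// ltW.
Qed.

Lemma discounted_cst (c : R) : discounted (fun=> c) = (c / (1 - beta))%:E.
Proof.
rewrite /discounted; apply/cvg_lim => //.
rewrite (_ : (fun _ => _) = EFin \o series (geometric c beta)).
  apply: cvg_EFin; first exact: nearW.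
  by apply: cvg_geometric_series; rewrite ger0_norm ?ltW.
apply/funext => n /=; rewrite sumEFin /series /=; congr (_%:E).
by apply: eq_bigr => i _; rewrite mulrC.
Qed.

Lemma discounted_le v (M : R) : (forall t, 0 <= v t) -> (forall t, v t <= M) ->
  (discounted v <= (M / (1 - beta))%:E)%E.
Proof.
move=> v0 vM; rewrite -discounted_cst; apply: lee_nneseries => t *.
  by rewrite lee_fin mulr_ge0// exprn_ge0// ltW.
by rewrite lee_fin ler_wpM2l// exprn_ge0// ltW.
Qed.

(** Summation by parts: the partial sums of [x] enter with nonnegative weights, so their sign passes
    to the discounted sum. *)
Lemma abel_sum x n :
  \sum_(t < n.+1) beta ^+ t * x t =
  beta ^+ n * \sum_(u < n.+1) x u +
  \sum_(t < n) (1 - beta) * beta ^+ t * \sum_(u < t.+1) x u.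
Proof.
elim: n => [|n IH]; first by rewrite big_ord0 !big_ord_recr !big_ord0 /=; lra.
rewrite big_ord_recr /= IH [in RHS]big_ord_recr /= [X in _ = _ + X]big_ord_recr /=.
by rewrite exprS; lra.
Qed.

Lemma abel_ge x k n : (forall m, 0 <= \sum_(u < m) x u) -> (k < n)%N ->
  (1 - beta) * beta ^+ k * \sum_(u < k.+1) x u <=
  \sum_(t < n.+1) beta ^+ t * x t.
Proof.
move=> x0 kn; rewrite abel_sum (bigD1 (Ordinal kn))//= addrCA lerDl.
have b0 m : 0 <= beta ^+ m by rewrite exprn_ge0 ?ltW.
apply: addr_ge0; first exact: mulr_ge0 (b0 _) (x0 _).
apply: sumr_ge0 => i _; apply: mulr_ge0 (x0 _); apply: mulr_ge0 (b0 _).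
by rewrite subr_ge0 ltW.
Qed.

(** Keeping only term [k] of the summation by parts for [g - v] quantifies the gap: the sign of this
    term gives dominance, and equality forces it to vanish for every [k]. *)
Lemma discounted_gap v g k : (forall t, 0 <= v t) -> (forall t, 0 <= g t) ->
  (forall t, \sum_(u < t) v u <= \sum_(u < t) g u) ->
  (discounted v <= discounted g -
     ((1 - beta) * beta ^+ k * \sum_(u < k.+1) (g u - v u))%:E)%E.
Proof.
move=> v0 g0 vg.
have bv0 x t : (forall t, 0 <= x t) -> (0 <= (beta ^+ t * x t)%:E)%E.
  by move=> x0; rewrite lee_fin mulr_ge0// exprn_ge0// ltW.
have cvgv : cvgn (fun n => \sum_(0 <= t < n) (beta ^+ t * v t)%:E)%E.
  by apply: is_cvg_nneseries => t _ _; apply: bv0.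
(* From [k.+2] terms on, the truncation contains the term that [abel_ge] keeps. *)
apply: lime_le => //; exists k.+2 => // -[//|n] kn.
rewrite leeBrDr//; apply: (@le_trans _ _ (\sum_(0 <= t < n.+1) (beta ^+ t * g t)%:E)%E).
  rewrite !sumEFin -EFinD lee_fin !big_mkord -lerBrDl -sumrB.
  under [leRHS]eq_bigr do rewrite -mulrBr.
  by apply: (@abel_ge (fun u => g u - v u)) => // m; rewrite sumrB subr_ge0.
by apply: nneseries_lim_ge => t _ _; apply: bv0.
Qed.

Lemma discounted_dom v g : (forall t, 0 <= v t) -> (forall t, 0 <= g t) ->
  (forall t, \sum_(u < t) v u <= \sum_(u < t) g u) ->
  (discounted v <= discounted g)%E.
Proof.
move=> v0 g0 vg; apply: le_trans (discounted_gap 0 v0 g0 vg) _.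
rewrite leeBlDr// leeDl// lee_fin sumrB !mulr_ge0 ?subr_ge0 ?exprn_ge0//.
all: exact: ltW.
Qed.

(** The bound [M] makes [discounted g] finite, so it cancels in [discounted_gap]; all partial sums
    then agree, hence so do the terms. *)
Lemma discounted_inj v g (M : R) : (forall t, 0 <= v t) -> (forall t, 0 <= g t) ->
  (forall t, g t <= M) ->
  (forall t, \sum_(u < t) v u <= \sum_(u < t) g u) ->
  discounted v = discounted g -> forall t, v t = g t.
Proof.
move=> v0 g0 gM vg E.
have gfin : discounted g \is a fin_num.
  by rewrite ge0_fin_numE ?discounted_ge0// (le_lt_trans (discounted_le g0 gM)) ?ltry.
have S t : \sum_(u < t) v u = \sum_(u < t) g u.
  case: t => [|k]; first by rewrite !big_ord0.
  apply/eqP; rewrite eq_le vg /=; have := discounted_gap k v0 g0 vg.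
  rewrite E -(fineK gfin) -EFinB lee_fin lerDl oppr_ge0.
  by rewrite pmulr_rle0 ?mulr_gt0 ?exprn_gt0 ?subr_gt0// sumrB subr_le0.
by move=> t; have := S t.+1; rewrite !big_ord_recr /= S => /addrI.
Qed.

End Discounting.

(** * Pathwise evaluation of the reward and of both integrands *)

Section PathReward.
Context {dT : measure_display} {Omega : measurableType dT} {R : realType} {d : nat}.
Variable beta : R.
Hypotheses (hb0 : 0 < beta) (hb1 : beta < 1).
Variables (h' : 'I_d -> nat -> Omega -> R) (w : Omega).
Hypothesis hpos : forall i t, (0 < t)%N -> 0 < h' i t w.

Local Notation h := (fun i t => h' i t w).

Lemma pulled_gt0 s T t : is_path s T -> 0 < pulled h T t.
Proof. by move=> Tp; have [j Tj] := proj2 Tp t; rewrite (pulledE h Tj) hpos. Qed.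

Lemma reward_ge0 (T : nat -> Omega -> 'I_d -> nat) : (0 <= reward beta h' T w)%E.
Proof.
apply: sume_ge0 => i _; apply: nneseries_ge0 => t _ _; rewrite lee_fin.
(* The sign of [h' i 0] is unknown, but in position 0 the truncated increment vanishes. *)
case: (T t.+1 w i) => [|n]; first by rewrite sub0n mulr0.
by apply: mulr_ge0 => //; rewrite mulr_ge0 ?exprn_ge0 ?ltW ?hpos.
Qed.

Lemma reward_discounted (T : nat -> Omega -> 'I_d -> nat) s :
  is_path s (T ^~ w) ->
  reward beta h' T w = discounted beta (pulled h (T ^~ w)).
Proof.
move=> Tp; rewrite /reward -nneseries_sum; last first.
  move=> i t _; rewrite lee_fin.
  case: (T t.+1 w i) => [|n]; first by rewrite sub0n mulr0.
  by apply: mulr_ge0 => //; rewrite mulr_ge0 ?exprn_ge0 ?ltW ?hpos.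
apply: eq_eseriesr => t _; rewrite sumEFin mulr_sumr; congr (_%:E).
by apply: eq_bigr => i _; rewrite mulrA.
Qed.

Variables (s : 'I_d -> nat) (G : nat -> 'I_d -> nat).
Hypothesis hdec : forall i u, h' i u.+2 w <= h' i u.+1 w.
Hypotheses (Gp : is_path s G) (Gg : greedy h G).

Variable V : 'I_d -> nat -> R -> Omega -> R.
(** The retirement criterion at the fixed outcome [w]; [V_eq_retire] supplies it for almost every
    outcome. *)
Hypothesis VE : forall i t m, 0 <= m ->
  (V i t m w = m <-> h' i t.+1 w <= (1 - beta) * m).

Lemma sigma_idxE i t m : 0 <= m ->
  sigma_idx V i t m w = hit (h i) t ((1 - beta) * m).
Proof.
move=> m0; rewrite /sigma_idx /hit; congr (ereal_inf [set _ | _ in _]).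
by apply/seteqP; split=> n /= [tn Vn]; split=> //; apply/(VE _ _ m0).
Qed.

Lemma tau_msE m : 0 <= m -> tau_ms V m s w = htau h s ((1 - beta) * m).
Proof. by move=> m0; apply: eq_bigr => i _; rewrite sigma_idxE. Qed.

Lemma sync_pulled_sigma T : is_path s T ->
  (forall (t : nat) (m : R), 0 < m ->
     (\sum_(i < d) mine ((T t i - s i)%N%:R%:E)
                        (sigma_idx V i (s i) m w - (s i)%:R%:E))%E
     = mine (t%:R%:E) (tau_ms V m s w)) <->
  (forall t, pulled h T t = pulled h G t).
Proof.
move=> Tp; rewrite -(sync_pulled hdec Gp Gg Tp); last 2 first.
- by move=> t; apply: pulled_gt0 Tp.
- by move=> t; apply: pulled_gt0 Gp.
have b1 : 0 < 1 - beta by rewrite subr_gt0.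
split=> H t m m0.
  have c0 : 0 < m / (1 - beta) by rewrite divr_gt0.
  have cE : (1 - beta) * (m / (1 - beta)) = m by rewrite mulrC divfK ?gt_eqF.
  have := H t _ c0; rewrite tau_msE ?ltW// cE => <-.
  by apply: eq_bigr => i _; rewrite sigma_idxE ?ltW// cE.
rewrite tau_msE ?ltW// -H ?mulr_gt0//.
by apply: eq_bigr => i _; rewrite sigma_idxE ?ltW.
Qed.

(** By [htau_le], the admissible [m] are those with [(1 - beta) m] at least the greedy pull at [t],
    so the infimum is attained at the quotient. *)
Lemma N_tsE t : N_ts V t s w = (pulled h G t / (1 - beta))%:E.
Proof.
have b1 : 0 < 1 - beta by rewrite subr_gt0.
apply/eqP; rewrite eq_le; apply/andP; split.
  apply: ge_ereal_inf; eexists; last exact: lexx.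
  eexists => //; split; first by rewrite divr_ge0 ?ltW// (pulled_gt0 _ Gp).
  rewrite tau_msE; last by rewrite divr_ge0 ?ltW// (pulled_gt0 _ Gp).
  by rewrite (htau_le hdec Gp Gg) mulrC divfK ?gt_eqF.
apply: le_ereal_inf_tmp => _ [m [m0 tau_le] <-].
move: tau_le; rewrite tau_msE// (htau_le hdec Gp Gg) => gm.
by rewrite lee_fin ler_pdivrMr// mulrC.
Qed.

Lemma discounted_N_ts :
  (\sum_(t <oo) ((beta ^+ t)%R%:E * N_ts V t s w))%E =
  ((1 - beta)^-1%:E * discounted beta (pulled h G))%E.
Proof.
rewrite -nneseriesZl; last first.
  by move=> t *; rewrite lee_fin mulr_ge0 ?exprn_ge0 ?ltW// (pulled_gt0 _ Gp).
apply: eq_eseriesr => t _; rewrite N_tsE -!EFinM; congr (_%:E).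
by rewrite mulrA mulrC.
Qed.

(** A finite geometric sum: the times counted are those before [htau]. When [htau] is infinite,
    [epow] is 0 and the whole series is summed. *)
Lemma one_sub_epow_htau c :
  ((1 - epow beta (htau h s c))%:E =
   (1 - beta)%:E * discounted beta (fun t => (c < pulled h G t)%R%:R))%E.
Proof.
have b1 : 0 < 1 - beta by rewrite subr_gt0.
have [[n -> En]|[-> Eoo]] := htau_cases hdec Gp Gg c; last first.
  rewrite (_ : (fun _ => _) = fun=> 1); last by apply/funext => t; rewrite Eoo.
  by rewrite discounted_cst// -EFinM mul1r divff ?gt_eqF// subr0.
rewrite /= powR_mulrn ?ltW// /discounted (nneseries_split _ n); last first.
  by move=> t *; rewrite lee_fin mulr_ge0// exprn_ge0// ltW.
rewrite [X in (_ + X)%E]eseries0 ?adde0; last first.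
  by move=> t nt _; rewrite En ltnNge nt mulr0.
rewrite add0n sumEFin -EFinM; congr (_%:E).
rewrite -[LHS]opprB subrX1 -mulNr opprB big_mkord; congr (_ * _).
by apply: eq_bigr => t _; rewrite En ltn_ord mulr1.
Qed.

(** A layer-cake computation: sum and integral are exchanged, and the set of [m] for which time [t]
    counts is an interval of length [pulled h G t / (1 - beta)]. *)
Lemma integral_epow :
  (\int[lebesgue_measure]_(m in [set m : R | (0 <= m)%R])
     (1 - epow beta (tau_ms V m s w))%R%:E)%E =
  discounted beta (pulled h G).
Proof.
have b1 : 0 < 1 - beta by rewrite subr_gt0.
pose f t (m : R) := (((1 - beta) * beta ^+ t) *
                     \1_(`[0, pulled h G t / (1 - beta)[%classic) m)%:E.
transitivity (\int[lebesgue_measure]_(m in [set m : R | (0 <= m)%R])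
                (\sum_(t <oo) f t m))%E.
  apply: eq_integral => m /set_mem /= m0; rewrite tau_msE// one_sub_epow_htau.
  rewrite -nneseriesZl; last first.
    by move=> t *; rewrite lee_fin mulr_ge0// exprn_ge0// ltW.
  apply: eq_eseriesr => t _; rewrite -EFinM /f indicE mem_setE in_itv /= m0 /=.
  by rewrite ltr_pdivlMr// [m * _]mulrC mulrA.
have m0 : measurable [set m : R | 0 <= m].
  by rewrite -set_itv_c_infty//; exact: measurable_itv.
have mf t : measurable_fun [set m : R | 0 <= m] (f t).
  by apply/measurable_EFinP/measurable_funM => //; exact: measurable_indic.
have bb0 t : 0 <= (1 - beta) * beta ^+ t by rewrite mulr_ge0 ?exprn_ge0 ?ltW.
rewrite integral_nneseries//; last first.
  by move=> t m _; rewrite lee_fin mulr_ge0.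
apply: eq_eseriesr => t _; rewrite /f.
under eq_integral do rewrite EFinM.
rewrite ge0_integralZl_EFin//; last first.
  by apply/measurable_EFinP; exact: measurable_indic.
rewrite integral_indic//.
rewrite (_ : _ `&` _ = `[0, pulled h G t / (1 - beta)[%classic); last first.
  by rewrite setIidl// => m /=; rewrite in_itv /= => /andP[].
rewrite [X in (_ * X)%E](_ : _ = (pulled h G t / (1 - beta))%:E); last first.
  rewrite [LHS]lebesgue_measure_itv /= lte_fin divr_gt0 ?(pulled_gt0 _ Gp)//.
  by rewrite -EFinB subr0.
rewrite -EFinM; congr (_%:E); field.
by rewrite gt_eqF.
Qed.

End PathReward.

Section Nonnegativity.
Context {dT : measure_display} {Omega : measurableType dT} {R : realType}.
Variables (d : nat) (V : 'I_d -> nat -> R -> Omega -> R).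

(** [cond_exp_of] asks for nonnegativity at every outcome, also where the retirement criterion may
    fail; hence bounds that hold without it. *)
Lemma tau_ms_ge0 m s w : (0 <= tau_ms V m s w)%E.
Proof.
apply: sume_ge0 => i _; rewrite sube_ge0 ?orbT//.
by apply: le_ereal_inf_tmp => _ [n [sn _] <-]; rewrite lee_fin ler_nat.
Qed.

Lemma N_ts_ge0 t s w : (0 <= N_ts V t s w)%E.
Proof. by apply: le_ereal_inf_tmp => _ [m [m0 _] <-]; rewrite lee_fin. Qed.

Lemma epow_le1 (beta : R) x : 0 < beta -> beta <= 1 -> (0 <= x)%E ->
  epow beta x <= 1.
Proof.
move=> b0 b1; case: x => [r| |] //=; rewrite lee_fin => r0.
by rewrite -(powRr0 beta) ger_powR// b0.
Qed.

End Nonnegativity.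

(** * Conditional expectations *)

Section ConditionalExpectation.
Context {dT : measure_display} {Omega : measurableType dT} {R : realType}.
Variable P : probability Omega R.
Local Open Scope ereal_scope.

Section SubSigmaAlgebra.
Variable G : set (set Omega).
Hypotheses (Gsig : sigma_algebra setT G) (Gsub : G `<=` measurable).

Local Notation gG := (g_sigma_algebraType G).

Let gGE (A : set gG) : measurable A <-> G A.
Proof. by rewrite (measurable_g_measurableTypeE Gsig). Qed.

Let gGm (A : set gG) : measurable A -> measurable (A : set Omega).
Proof. by move=> /gGE; exact: Gsub. Qed.

(** Opens [G] to the usual measurability lemmas: a sigma-algebra generates itself. *)
Lemma emeas_wrtE (f : Omega -> \bar R) :
  emeas_wrt G f <-> measurable_fun [set: gG] (f : gG -> \bar R).
Proof.
split=> [mf _ B mB|mf B mB]; first by rewrite setTI; apply/gGE/mf.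
by apply/gGE; rewrite -[X in measurable X]setTI; apply: mf.
Qed.

Lemma meas_wrtE (f : Omega -> R) :
  meas_wrt G f <-> measurable_fun [set: gG] (f : gG -> R).
Proof.
split=> [mf _ B mB|mf B mB]; first by rewrite setTI; apply/gGE/mf.
by apply/gGE; rewrite -[X in measurable X]setTI; apply: mf.
Qed.

Lemma emeas_wrt_measurable (f : Omega -> \bar R) :
  emeas_wrt G f -> measurable_fun setT f.
Proof. by move=> mf _ B mB; rewrite setTI; apply/Gsub/mf. Qed.

(* [P] on the sub-sigma-algebra, where Radon-Nikodym is applied. *)
Definition trace_prob : set gG -> \bar R := fun A => P A.

Let trace_prob0 : trace_prob set0 = 0.
Proof. exact: measure0. Qed.

Let trace_prob_ge0 A : 0 <= trace_prob A.
Proof. exact: measure_ge0. Qed.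

Let trace_prob_additive : semi_sigma_additive trace_prob.
Proof.
move=> F mF tF mUF; apply: measure_semi_sigma_additive => // [i|].
  exact: gGm.
exact: gGm.
Qed.

HB.instance Definition _ := isMeasure.Build _ _ _ trace_prob
  trace_prob0 trace_prob_ge0 trace_prob_additive.

Let trace_prob_fin : fin_num_fun trace_prob.
Proof. by move=> A /gGm mA; apply: fin_num_measure. Qed.

HB.instance Definition _ := Measure_isFinite.Build _ _ _ trace_prob trace_prob_fin.

(** The restricted measure is the pushforward of [P] under the identity from [Omega] to [gG]. *)
Lemma integral_trace_prob (f : Omega -> \bar R) A : G A ->
  emeas_wrt G f -> (forall w, 0 <= f w) ->
  \int[trace_prob]_(w in A) f w = \int[P]_(w in A) f w.
Proof.
move=> /gGE mA /emeas_wrtE mf f0.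
have mid : measurable_fun [set: Omega] (id : Omega -> gG).
  by move=> _ B /gGm mB; rewrite setTI.
rewrite -[RHS](ge0_integral_pushforward mid P)//.
by apply: measurable_funTS.
Qed.

Section Density.
Variable X : Omega -> \bar R.
Hypotheses (mX : measurable_fun setT X) (X0 : forall w, 0 <= X w).
Hypothesis Xfin : \int[P]_w X w < +oo.

Definition trace_density : set gG -> \bar R := fun A => \int[P]_(w in A) X w.

Let trace_density0 : trace_density set0 = 0.
Proof. exact: integral_set0. Qed.

Let trace_density_ge0 A : 0 <= trace_density A.
Proof. exact: integral_ge0. Qed.

Let trace_density_additive : semi_sigma_additive trace_density.
Proof.
move=> F mF tF mUF.
have add : semi_sigma_additive (fun A : set Omega => \int[P]_(w in A) X w).
  exact: semi_sigma_additive_nng_induced.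
by apply: add => // [i|]; exact: gGm.
Qed.

HB.instance Definition _ := isMeasure.Build _ _ _ trace_density
  trace_density0 trace_density_ge0 trace_density_additive.

Let trace_density_fin : fin_num_fun trace_density.
Proof.
move=> A /gGm mA; rewrite ge0_fin_numE ?integral_ge0//.
by apply: le_lt_trans Xfin; apply: ge0_subset_integral.
Qed.

HB.instance Definition _ :=
  Measure_isFinite.Build _ _ _ trace_density trace_density_fin.

(** The conditional expectation is the Radon-Nikodym derivative of [trace_density] with respect to
    [trace_prob]. *)
Lemma cond_exp_exists : exists Y, cond_exp_of P G X Y.
Proof.
have /radon_nikodym_finite[Y [Y0 intY YE]] : trace_density `<< trace_prob.
  apply/null_content_dominatesP => A /gGm mA PA0.
  rewrite /trace_density; under eq_integral do rewrite -[X _]gee0_abs//.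
  by apply: integral_abs_eq0 => //; exact: measurable_funTS.
have mY : emeas_wrt G Y by apply/emeas_wrtE; exact: measurable_int intY.
exists Y; split=> // A GA; rewrite -integral_trace_prob// -YE//.
exact/gGE.
Qed.

End Density.

(** Tested on the event [A] where [Y2 < Y1]: there the integral of [Y1] is at most that of [Y2], so
    both functions agree almost everywhere on [A], which is therefore null. *)
Lemma cond_exp_le (X1 X2 Y1 Y2 : Omega -> \bar R) :
  cond_exp_of P G X1 Y1 -> cond_exp_of P G X2 Y2 ->
  {ae P, forall w, X1 w <= X2 w} -> \int[P]_w X2 w < +oo ->
  {ae P, forall w, Y1 w <= Y2 w}.
Proof.
move=> [mX1 X10 mY1 Y10 YE1] [mX2 X20 mY2 Y20 YE2] X12 X2fin.
pose A := [set w | Y2 w < Y1 w].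
have GA : G A.
  apply/gGE; rewrite -[X in measurable X]setTI.
  by apply: measurable_lte => //; apply/emeas_wrtE.
have mA := Gsub GA.
have mY1' := emeas_wrt_measurable mY1.
have mY2' := emeas_wrt_measurable mY2.
have le21 : \int[P]_(w in A) Y1 w <= \int[P]_(w in A) Y2 w.
  rewrite YE1// YE2//; apply: ae_ge0_le_integral => //.
  - exact: measurable_funTS.
  - exact: measurable_funTS.
  - by apply: filterS X12 => w + _.
have fin2 : \int[P]_(w in A) Y2 w < +oo.
  rewrite YE2//; apply: le_lt_trans X2fin; exact: ge0_subset_integral.
have intY2 : P.-integrable A Y2.
  apply/integrableP; split; first exact: measurable_funTS.
  by under eq_integral do rewrite gee0_abs//.
have eq12 : ae_eq P A Y2 Y1.
  apply: integral_ae_eq => //; first exact: measurable_funTS.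
  move=> E EA mE; apply/eqP; rewrite eq_le; apply/andP; split.
    apply: ge0_le_integral => //; try exact: measurable_funTS.
    by move=> w /EA /ltW.
  (* For a subset [E] of [A] the reverse inequality follows by splitting off the rest of [A] and
     cancelling the finite integral of [Y2] there. *)
  have splitA (f : Omega -> \bar R) : measurable_fun setT f -> (forall w, 0 <= f w) ->
      \int[P]_(w in A) f w = \int[P]_(w in E) f w + \int[P]_(w in A `\` E) f w.
    move=> mf f0; rewrite -ge0_integral_setU//.
    - by rewrite setDUK.
    - exact: measurableD.
    - exact: measurable_funTS.
    - by rewrite disj_set2E setDIK.
  move: le21; rewrite !splitA//.
  have D12 : \int[P]_(w in A `\` E) Y2 w <= \int[P]_(w in A `\` E) Y1 w.
    apply: ge0_le_integral => //; try exact: measurable_funTS.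
      exact: measurableD.
    by move=> w [/ltW].
  have Dfin : \int[P]_(w in A `\` E) Y2 w \is a fin_num.
    rewrite ge0_fin_numE ?integral_ge0//; apply: le_lt_trans fin2.
    by apply: ge0_subset_integral => //; [exact: measurableD|exact: measurable_funTS].
  move=> le21; rewrite -(leeD2rE _ _ Dfin); apply: le_trans le21.
  by rewrite leeD2l.
apply: filterS eq12 => w /= Aeq; rewrite leNgt; apply/negP => Aw.
by move: (Aw); rewrite Aeq ?ltxx.
Qed.

End SubSigmaAlgebra.

(** Completeness makes [X'] measurable. This is how integrands built from [V], identified only
    almost surely, become measurable. *)
Lemma cond_exp_transfer G (X X' Y : Omega -> \bar R) :
  measure_is_complete P -> {ae P, forall w, X w = X' w} ->
  (forall w, 0 <= X' w) -> G `<=` measurable ->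
  cond_exp_of P G X Y -> cond_exp_of P G X' Y.
Proof.
move=> Pc XX' X'0 Gsub [mX X0 mY Y0 YE].
have aeXX' A : ae_eq P A X X' by apply: filterS XX' => w ->.
have mX' : measurable_fun setT X' by apply: (ae_measurable_fun Pc (aeXX' _)).
split=> // A GA; rewrite YE//; apply: ge0_ae_eq_integral => //.
- exact: Gsub.
- exact: measurable_funTS.
- exact: measurable_funTS.
Qed.

Lemma cond_exp_self G (X : Omega -> \bar R) : G `<=` measurable ->
  emeas_wrt G X -> (forall w, 0 <= X w) -> cond_exp_of P G X X.
Proof. by move=> Gsub mX X0; split=> //; apply: emeas_wrt_measurable mX. Qed.

Lemma cond_exp_scale G (X Y : Omega -> \bar R) (k : R) :
  sigma_algebra setT G -> G `<=` measurable -> (0 <= k)%R ->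
  cond_exp_of P G X Y -> cond_exp_of P G (fun w => k%:E * X w) (fun w => k%:E * Y w).
Proof.
move=> Gsig Gsub k0 [mX X0 mY Y0 YE]; split.
- exact: measurable_funeM.
- by move=> w; rewrite mule_ge0.
- by apply/(emeas_wrtE Gsig); apply: measurable_funeM; apply/emeas_wrtE.
- by move=> w; rewrite mule_ge0.
- move=> A GA; have mA := Gsub _ GA.
  rewrite !ge0_integralZl ?YE//; first exact: measurable_funTS.
  by apply: measurable_funTS; apply: emeas_wrt_measurable mY.
Qed.

(** The difference [g - f] is nonnegative with zero integral; finiteness makes the subtraction
    legitimate. *)
Lemma le_integral_eq_ae (f g : Omega -> \bar R) :
  measurable_fun setT f -> measurable_fun setT g ->
  (forall w, 0 <= f w) -> (forall w, f w <= g w) -> (forall w, g w < +oo) ->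
  \int[P]_w g w < +oo -> \int[P]_w f w = \int[P]_w g w ->
  {ae P, forall w, f w = g w}.
Proof.
move=> mf mg f0 fg gfin intg E.
have g0 w : 0 <= g w := le_trans (f0 w) (fg w).
have fn (h : Omega -> \bar R) : measurable_fun setT h -> (forall w, 0 <= h w) ->
    \int[P]_w h w < +oo -> P.-integrable setT h.
  move=> mh h0 hfin; apply/integrableP; split=> //.
  by under eq_integral do rewrite gee0_abs//.
have /ae_eq_integral_abs : \int[P]_w `|g w - f w| = 0.
  under eq_integral do rewrite gee0_abs ?sube_ge0 ?ge0_fin_numE ?gfin ?orbT//.
  rewrite integralB//; [rewrite E subee// ge0_fin_numE ?integral_ge0//|exact: fn|].
  by apply: fn => //; rewrite E.
move=> /(_ measurableT (emeasurable_funB mg mf)); apply: filterS => w /(_ I) /= gf.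
have gw : g w \is a fin_num by rewrite ge0_fin_numE.
have fw : f w \is a fin_num by rewrite ge0_fin_numE// (le_lt_trans (fg w)).
by move: gf; rewrite -(fineK gw) -(fineK fw) -EFinB => -[/subr0_eq ->].
Qed.

End ConditionalExpectation.

(** * Optimal retirement for decreasing rewards *)

Section RationalBounds.
Context {R : realType}.

(** The fractions [p / q.+1] are dense in the half-line: truncating [m * n.+1] and dividing by
    [n.+1] approaches [m] from below without leaving it. *)
Lemma within_le (f g : R -> R) :
  {within [set m : R | 0 <= m], continuous f} ->
  {within [set m : R | 0 <= m], continuous g} ->
  (forall p q : nat, f (p%:R / q.+1%:R) <= g (p%:R / q.+1%:R)) ->
  forall m, 0 <= m -> f m <= g m.
Proof.
move=> /subspace_continuousP cf /subspace_continuousP cg fg m m0.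
pose u n : R := (Num.truncn (m * n.+1%:R))%:R / n.+1%:R.
have u0 n : 0 <= u n by rewrite divr_ge0.
have um : u n @[n --> \oo] --> m.
  apply: (@squeeze_cvgr _ _ _ _ (fun n => m - harmonic n) (fun=> m)).
  - apply: nearW => n; have n0 : 0 < n.+1%:R :> R by rewrite ltr0n.
    have mn0 : 0 <= m * n.+1%:R by rewrite mulr_ge0.
    rewrite /u /=; apply/andP; split; last by rewrite ler_pdivrMr// truncn_le.
    rewrite ler_pdivlMr// mulrBl mulVf ?gt_eqF// lerBlDr.
    by rewrite natr1 ltW// truncnS_gt.
  - rewrite -[X in _ --> X]subr0; apply: cvgB; first exact: cvg_cst.
    exact: cvg_harmonic.
  - exact: cvg_cst.
have uw : u n @[n --> \oo] --> within [set m : R | 0 <= m] (nbhs m).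
  move=> B; rewrite /within /= => /um [N _ NB]; exists N => // n /NB; apply.
  exact: u0.
apply: (@ler_cvg_to _ \oo _ _ (f \o u) (g \o u)).
- exact: cvg_comp uw (cf m m0).
- exact: cvg_comp uw (cg m m0).
- by apply: nearW => n; exact: fg.
Qed.

End RationalBounds.

Section RetirementValue.
Context {dT : measure_display} {Omega : measurableType dT} {R : realType}.
Variables (P : probability Omega R) (d : nat).
Variable beta : R.
Hypotheses (hb0 : 0 < beta) (hb1 : beta < 1).
Variable Filt : ('I_d -> nat) -> set (set Omega).
Hypotheses (Fsig : forall s, sigma_algebra setT (Filt s))
  (Fsub : forall s, Filt s `<=` measurable).
Variable h' : 'I_d -> nat -> Omega -> R.
Hypotheses (hpos : forall i t w, (0 < t)%N -> 0 < h' i t w)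
  (hdec : forall i t w, (0 < t)%N -> h' i t.+1 w <= h' i t w)
  (hbdd : forall i, exists M : R, forall t w, (0 < t)%N -> h' i t w <= M)
  (hpred : forall i t, (0 < t)%N -> meas_wrt (Fi Filt i t.-1) (h' i t)).

Lemma stopping_time_cst i t n : (t <= n)%N ->
  stopping_time_from Filt i t (fun=> Some n).
Proof.
move=> tn; split=> [w k [<-]//|k].
have [F0 FC _] := Fsig (unitvec i k).
have [nk|nk] := eqVneq n k.
  rewrite nk (_ : [set w | _] = setT `\` set0); last first.
    by rewrite setD0; apply/seteqP; split.
  exact: FC.
rewrite (_ : [set w | _] = set0)//; apply/seteqP; split=> // w /= [] /eqP.
by rewrite (negPf nk).
Qed.

(** All rewards from [t] on are at most [(1 - beta) c], so [k] of them are worth at most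
    [(1 - beta ^+ k) c], and retiring afterwards adds at most [beta ^+ k * c]. *)
Lemma payoffV_le i t m tau (c : R) w :
  stopping_time_from Filt i t tau -> 0 <= m -> m <= c ->
  h' i t.+1 w <= (1 - beta) * c ->
  (payoffV beta h' i t m tau w <= c%:E)%E.
Proof.
move=> [tau_ge _] m0 mc hc.
have hle u : (t <= u)%N -> h' i u.+1 w <= (1 - beta) * c.
  move=> /subnK <-; elim: (u - t)%N => // k IH.
  by rewrite addSn (le_trans (hdec _ _ _)).
have b0 k : 0 <= beta ^+ k by rewrite exprn_ge0 ?ltW.
have partial k : \sum_(t <= u < t + k) beta ^+ (u - t) * h' i u.+1 w <=
    (1 - beta ^+ k) * c.
  elim: k => [|k IH]; first by rewrite addn0 big_geq// subrr mul0r.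
  rewrite addnS big_nat_recr ?leq_addr//= addKn.
  have := ler_wpM2l (b0 k) (hle _ (leq_addr k t)).
  by move=> /(lerD IH)/le_trans; apply; rewrite exprS; lra.
have finite n : (t <= n)%N ->
    \sum_(t <= u < n) beta ^+ (u - t) * h' i u.+1 w + m * beta ^+ (n - t) <= c.
  move=> tn; have := partial (n - t)%N; rewrite subnKC// => /lerD.
  move=> /(_ _ _ (ler_wpM2r (b0 (n - t)%N) mc))/le_trans; apply.
  by rewrite mulrBl mul1r [c * _]mulrC subrK.
rewrite /payoffV; case E : (tau w) => [n|].
  by rewrite lee_fin finite// (tau_ge w).
have term0 u : (0 <= (beta ^+ (u - t) * h' i u.+1 w)%:E)%E.
  by rewrite lee_fin mulr_ge0// ltW// hpos.
(* Without retirement the payoff is a limit of finite payoffs deprived of their nonnegative last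
   term. *)
apply: lime_le; first by apply: is_cvg_nneseries => u _ _; exact: term0.
exists t => // n tn; rewrite sumEFin lee_fin; apply: le_trans (finite n tn).
by rewrite lerDl mulr_ge0.
Qed.

Variable V : 'I_d -> nat -> R -> Omega -> R.
Hypothesis hV : forall i t m, 0 <= m ->
  is_ess_sup P (Fi Filt i t) (famV P Filt beta h' i t m)
    (fun w => (V i t m w)%:E).

Let Fisig i t : sigma_algebra setT (Fi Filt i t). Proof. exact: Fsig. Qed.

Let Fisub i t : Fi Filt i t `<=` measurable. Proof. exact: Fsub. Qed.

Let mh i t : measurable_fun [set: g_sigma_algebraType (Fi Filt i t)] (h' i t.+1).
Proof.
have := hpred i (ltn0Sn t).
by rewrite (meas_wrtE (@Fisig _ _)).
Qed.

(* Rewards up to time t + 1 are known at time t, so no averaging is involved. *)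
Lemma famV_measurable i t m n (X : Omega -> R) : (t <= n)%N ->
  measurable_fun [set: g_sigma_algebraType (Fi Filt i t)] X ->
  (forall w, 0 <= X w) ->
  (forall w, payoffV beta h' i t m (fun=> Some n) w = (X w)%:E) ->
  famV P Filt beta h' i t m (EFin \o X).
Proof.
move=> tn mX X0 XE; exists (fun=> Some n); split; first exact: stopping_time_cst.
rewrite (_ : payoffV _ _ _ _ _ _ = EFin \o X); last exact/funext.
apply: cond_exp_self => //; apply/(emeas_wrtE (@Fisig _ _)).
exact/measurable_EFinP.
Qed.

(** Comparison with immediate retirement. *)
Lemma V_ge i t m : 0 <= m -> {ae P, forall w, m <= V i t m w}.
Proof.
move=> m0; have [_ ub _] := hV i t m0.
apply: filterS (ub (EFin \o cst m) _) => [w|]; first by rewrite lee_fin.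
apply: (famV_measurable (leqnn t)) => // w.
by rewrite /payoffV big_geq// subnn mulr1 add0r.
Qed.

(** Comparison with engaging once and then retiring. *)
Lemma V_ge_step i t m : 0 <= m ->
  {ae P, forall w, h' i t.+1 w + beta * m <= V i t m w}.
Proof.
move=> m0; have [_ ub _] := hV i t m0.
apply: filterS (ub (EFin \o (fun w => h' i t.+1 w + beta * m)) _) => [w|].
  by rewrite lee_fin.
apply: (famV_measurable (leqnSn t)).
- exact: measurable_funD.
- by move=> w; apply: addr_ge0; [exact/ltW/hpos|exact: mulr_ge0 (ltW hb0) m0].
- move=> w; rewrite /payoffV big_nat1 subnn mul1r subSnn expr1.
  by rewrite [m * _]mulrC.
Qed.

(** The maximum is the least [c] to which [payoffV_le] applies. It is known at time [t], hence
    bounds every conditional payoff and so their essential supremum. *)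
Lemma V_le i t m : 0 <= m ->
  {ae P, forall w, V i t m w <= Num.max m (h' i t.+1 w / (1 - beta))}.
Proof.
move=> m0; have [_ _ lub] := hV i t m0.
have b1 : 0 < 1 - beta by rewrite subr_gt0.
pose c w := Num.max m (h' i t.+1 w / (1 - beta)).
have c0 w : 0 <= c w by rewrite le_max m0.
have mc : emeas_wrt (Fi Filt i t) (EFin \o c).
  apply/(emeas_wrtE (@Fisig _ _))/measurable_EFinP.
  by apply: measurable_maxr => //; apply: measurable_funM.
have [M hM] := hbdd i.
have cM w : c w <= m + `|M| / (1 - beta).
  rewrite ge_max; apply/andP; split; first by rewrite lerDl divr_ge0// ltW.
  apply: (@le_trans _ _ (`|M| / (1 - beta))); last by rewrite lerDr.
  by rewrite ler_pM2r ?invr_gt0//; apply: le_trans (ler_norm _); exact: hM.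
have cfin : (\int[P]_w (EFin \o c) w < +oo)%E.
  apply: (@le_lt_trans _ _ (\int[P]_w (m + `|M| / (1 - beta))%:E)%E).
    apply: ge0_le_integral => //.
    - by move=> w _; rewrite lee_fin.
    - exact: (emeas_wrt_measurable (@Fisub i t) mc).
    - by move=> w _; rewrite lee_fin.
  by rewrite integral_cst//= probability_setT mule1 ltry.
apply: filterS (lub (EFin \o c) mc _) => [w|]; first by rewrite lee_fin.
move=> X [tau [tau_st cX]].
apply: (cond_exp_le (@Fisig _ _) (@Fisub _ _) cX _ _ cfin).
  by apply: cond_exp_self => // w; rewrite lee_fin.
apply: aeW => w; apply: payoffV_le => //; first by rewrite le_max lexx.
by rewrite mulrC -ler_pdivrMr// le_max lexx orbT.
Qed.

Hypothesis hVcont : forall i t w,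
  {within [set m : R | 0 <= m], continuous (fun m => V i t m w)}.

(* Each bound above holds almost surely for a fixed m; continuity of V in m
   upgrades countably many of them to a single null set for all m. *)
Lemma V_eq_retire : {ae P, forall w, forall i t m, 0 <= m ->
  (V i t m w = m <-> h' i t.+1 w <= (1 - beta) * m)}.
Proof.
have b1 : 0 < 1 - beta by rewrite subr_gt0.
apply: filter_forall => i; apply: ae_foralln => t.
have : {ae P, forall w, forall p q : nat, let m : R := p%:R / q.+1%:R in
    [/\ m <= V i t m w, h' i t.+1 w + beta * m <= V i t m w &
        V i t m w <= Num.max m (h' i t.+1 w / (1 - beta))]}.
  apply: ae_foralln => p; apply: ae_foralln => q.
  have m0 : 0 <= p%:R / q.+1%:R :> R by rewrite divr_ge0.
  by apply: filterS3 (V_ge i t m0) (V_ge_step i t m0) (V_le i t m0).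
apply: filterS => w Vpq m m0.
have cid : {within [set m : R | 0 <= m], continuous (fun m : R => m)}.
  by apply: continuous_subspaceT => x; exact: cvg_id.
have Vm : m <= V i t m w.
  by apply: (within_le cid (@hVcont i t w) _ m0) => p q; have [] := Vpq p q.
have hVm : h' i t.+1 w + beta * m <= V i t m w.
  apply: (@within_le _ (fun m => h' i t.+1 w + beta * m) (fun m => V i t m w)) => //.
  - apply: continuous_subspaceT => x; apply: cvgD; first exact: cvg_cst.
    by apply: cvgM; [exact: cvg_cst|exact: cvg_id].
  - by move=> p q; have [] := Vpq p q.
have Vmax : V i t m w <= Num.max m (h' i t.+1 w / (1 - beta)).
  apply: (within_le (g := fun m => Num.max m (h' i t.+1 w / (1 - beta)))
    (@hVcont i t w) _ _ m0); last by move=> p q; have [] := Vpq p q.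
  apply: continuous_subspaceT => x.
  by apply: (@continuous_max R R (fun m => m)); [exact: cvg_id|exact: cvg_cst].
(* If [V = m], the one-step bound gives the criterion; conversely the criterion reduces the upper
   bound to [m]. *)
split=> [Ve|hm]; first by lra.
apply/eqP; rewrite eq_le Vm andbT (le_trans Vmax)// ge_max lexx /=.
by rewrite ler_pdivrMr// mulrC.
Qed.

End RetirementValue.

(** * The greedy strategy *)

(** A choice made from finitely many measurable yes-no tests is measurable, being a finite union
    over the possible tables of answers. *)
Lemma measurable_ffun (dT : measure_display) (T : measurableType dT) (I : finType)
    (U : Type) (b : I -> T -> bool) (F : {ffun I -> bool} -> U) (u : U) :
  (forall p, measurable [set w | b p w]) ->
  measurable [set w | F [ffun p => b p w] = u].
Proof.
move=> mb.
rewrite (_ : [set w | _] = \bigcup_(f in [set f | F f = u])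
    \bigcap_(p in setT) [set w | b p w = f p]); last first.
  apply/seteqP; split=> [w /= Fu|w [f /= Fu bf]].
    by exists [ffun p => b p w] => // p _ /=; rewrite ffunE.
  by rewrite -Fu; congr F; apply/ffunP => p; rewrite ffunE; apply: bf.
apply: fin_bigcup_measurable => [|f _]; first exact: finite_finset.
apply: fin_bigcap_measurable => [|p _]; first exact: finite_finset.
case: (f p); first exact: mb.
rewrite (_ : [set w | _] = ~` [set w | b p w]); first exact: measurableC.
by apply/seteqP; split=> w /=; [move=> ->|move=> /negP/negPf].
Qed.

Section GreedyStrategy.
Context {dT : measure_display} {Omega : measurableType dT} {R : realType}.
Variables (d : nat) (j0 : 'I_d).
Variable Filt : ('I_d -> nat) -> set (set Omega).
Hypotheses (Fsig : forall s, sigma_algebra setT (Filt s))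
  (Fsub : forall s, Filt s `<=` measurable)
  (F1 : forall s r, (forall i, (s i <= r i)%N) -> Filt s `<=` Filt r).
Variable h' : 'I_d -> nat -> Omega -> R.
Hypothesis hpred : forall i t, (0 < t)%N -> meas_wrt (Fi Filt i t.-1) (h' i t).

Let FiltE r (A : set (g_sigma_algebraType (Filt r))) : measurable A <-> Filt r A.
Proof. by rewrite (measurable_g_measurableTypeE (Fsig r)). Qed.

(** Predictability places the next reward of arm [j] in the filtration at [r j] times the unit
    vector, which lies below [r]. *)
Lemma adapted_next_reward r j : meas_wrt (Filt r) (h' j (r j).+1).
Proof.
move=> B mB; apply: (F1 _ (hpred j (ltn0Sn (r j)) mB)) => i.
by rewrite /unitvec; case: eqVneq => // ->.
Qed.

(** The default [j0] only makes the choice total, since a maximizer exists; [pick] breaks ties using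
    the comparisons alone. *)
Definition best_arm (r : 'I_d -> nat) (w : Omega) : 'I_d :=
  odflt j0 [pick j | [forall k, h' k (r k).+1 w <= h' j (r j).+1 w]].

Lemma best_arm_max r w k :
  h' k (r k).+1 w <= h' (best_arm r w) (r (best_arm r w)).+1 w.
Proof.
rewrite /best_arm; case: pickP => [j /forallP/(_ k)//|none].
pose x := fun j => h' j (r j).+1 w.
have [j _ jmax] := @arg_maxP _ _ _ j0 xpredT x isT.
by have /negP[] := none j; apply/forallP => i; exact: jmax.
Qed.

Lemma measurable_best_arm r j : Filt r [set w | best_arm r w = j].
Proof.
apply/FiltE.
pose b (p : 'I_d * 'I_d) w := h' p.1 (r p.1).+1 w <= h' p.2 (r p.2).+1 w.
(* [F] recovers the chosen arm from the table of pairwise comparisons. *)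
pose F (f : {ffun 'I_d * 'I_d -> bool}) :=
  odflt j0 [pick j | [forall k, f (k, j)]].
rewrite (_ : [set w | _] = [set w | F [ffun p => b p w] = j]); last first.
  suff E w : best_arm r w = F [ffun p => b p w].
    by apply/seteqP; split=> w /=; rewrite E.
  congr odflt; apply: eq_pick => k /=; apply: eq_forallb => l.
  by rewrite ffunE.
apply: measurable_ffun => p.
have mh i : measurable_fun [set: g_sigma_algebraType (Filt r)]
    (EFin \o h' i (r i).+1).
  apply/measurable_EFinP/(meas_wrtE (Fsig r)).
  exact: adapted_next_reward.
rewrite -[X in measurable X]setTI /b.
have := measurable_lee measurableT (mh p.1) (mh p.2).
by congr measurable; congr (_ `&` _); apply/seteqP; split=> w /=; rewrite lee_fin.
Qed.

Variable s : 'I_d -> nat.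

Fixpoint greedy_strategy (t : nat) (w : Omega) : 'I_d -> nat :=
  if t is u.+1 then
    addunit (greedy_strategy u w) (best_arm (greedy_strategy u w) w)
  else s.

Lemma greedy_strategy_event r j t :
  Filt r [set w | greedy_strategy t w = r] ->
  Filt r [set w | greedy_strategy t.+1 w = addunit (greedy_strategy t w) j /\
                  greedy_strategy t w = r].
Proof.
move=> /FiltE mr; apply/FiltE.
rewrite (_ : [set w | _] = [set w | best_arm r w = j] `&`
                           [set w | greedy_strategy t w = r]); last first.
  apply/seteqP; split=> w /= [E Tr]; split=> //; last by rewrite Tr E.
  by move: E; rewrite Tr => /addunit_inj.
by apply: measurableI => //; apply/FiltE; exact: measurable_best_arm.
Qed.

Lemma greedy_strategy_state r t : Filt r [set w | greedy_strategy t w = r].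
Proof.
elim: t r => [|t IH] r.
  have [sr|sr] := pselect (s = r).
    apply/FiltE; rewrite (_ : [set w | _] = setT); first exact: measurableT.
    by apply/seteqP; split.
  apply/FiltE; rewrite (_ : [set w | _] = set0); first exact: measurable0.
  by apply/seteqP; split.
(* The possible predecessors of [r]; as the subtraction truncates, [D] keeps the arms for which it
   is undone by one step. *)
pose q j : 'I_d -> nat := fun k => (r k - (k == j))%N.
pose D := [set j | addunit (q j) j = r].
apply/FiltE; rewrite (_ : [set w | _] = \bigcup_(j in D)
  [set w | greedy_strategy t.+1 w = addunit (greedy_strategy t w) j /\
           greedy_strategy t w = q j]); last first.
  apply/seteqP; split=> [w /= Tr|w [j /= Dj [-> ->]]//].
  have qE : q (best_arm (greedy_strategy t w) w) = greedy_strategy t w.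
    by apply/funext => k; rewrite /q -Tr /addunit addnK.
  by exists (best_arm (greedy_strategy t w) w); rewrite /D/= qE.
apply: fin_bigcup_measurable => [|j Dj]; first exact: finite_finset.
apply/FiltE; apply: (F1 _ (greedy_strategy_event j (IH (q j)))) => i.
exact: leq_subr.
Qed.

Lemma greedy_strategy_alloc : alloc_strategy Filt s greedy_strategy.
Proof.
split=> [//|t w|j r t]; first by eexists.
exact/greedy_strategy_event/greedy_strategy_state.
Qed.

Lemma greedy_strategy_greedy w :
  greedy (fun i t => h' i t w) (greedy_strategy ^~ w).
Proof. by move=> t j /= /addunit_inj <- i; exact: best_arm_max. Qed.

Lemma alloc_is_path T w : alloc_strategy Filt s T -> is_path s (T ^~ w).
Proof. by move=> [T0 TS _]; split=> // t; exact: TS. Qed.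

Lemma measurable_pulled T t : alloc_strategy Filt s T ->
  measurable_fun setT (fun w => pulled (fun i t => h' i t w) (T ^~ w) t).
Proof.
move=> TA _ B mB; have [T0 TS TF] := TA; rewrite setTI.
(* One piece for each state and engaged arm; recording states as finite functions makes the index
   set countable. *)
pose E (p : {ffun 'I_d -> nat} * 'I_d) :=
  [set w | T t.+1 w = addunit (T t w) p.2 /\ T t w = p.1].
rewrite (_ : _ @^-1` _ = \bigcup_p
    (E p `&` (h' p.2 (p.1 p.2).+1) @^-1` B)); last first.
  apply/seteqP; split=> [w /= Bw|w [p _ [[Tj Tr] Bw]] /=].
    have [j Tj] := TS t w.
    have TE : T t w = [ffun i => T t w i] by apply/funext => i; rewrite ffunE.
    exists ([ffun i => T t w i], j) => //; split=> //=.
    by rewrite ffunE; rewrite (@pulledE _ _ _ (T ^~ w) t j) in Bw.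
  by rewrite (@pulledE _ _ _ (T ^~ w) t p.2)//= Tr.
apply: countable_bigcupT_measurable => [|p]; first exact: countableP.
apply: measurableI; first exact/Fsub/TF.
by apply/(Fsub (s := p.1))/adapted_next_reward.
Qed.

End GreedyStrategy.

(** * From pathwise identities to conditional expectations *)

Theorem theorem7p2
  (dT : measure_display) (Omega : measurableType dT) (R : realType)
  (P : probability Omega R) (Pcomplete : measure_is_complete P)
  (d : nat) (hd : (0 < d)%N)
  (beta : R) (hb0 : 0 < beta) (hb1 : beta < 1)
  (Filt : ('I_d -> nat) -> set (set Omega))
  (Fsig : forall s, sigma_algebra setT (Filt s))
  (Fsub : forall s, Filt s `<=` measurable)
  (F1 : forall s r, (forall i, (s i <= r i)%N) -> Filt s `<=` Filt r)
  (F2 : forall N, P.-negligible N -> Filt (fun _ => 0%N) N)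
  (h' : 'I_d -> nat -> Omega -> R)
  (hpos : forall i t w, (0 < t)%N -> 0 < h' i t w)
  (hdec : forall i t w, (0 < t)%N -> h' i t.+1 w <= h' i t w)
  (hbdd : forall i, exists M : R, forall t w, (0 < t)%N -> h' i t w <= M)
  (hpred : forall i t, (0 < t)%N -> meas_wrt (Fi Filt i t.-1) (h' i t))
  (V : 'I_d -> nat -> R -> Omega -> R)
  (hV : forall i t m, 0 <= m ->
     is_ess_sup P (Fi Filt i t) (famV P Filt beta h' i t m)
       (fun w => (V i t m w)%:E))
  (hVcont : forall i t w,
     {within [set m : R | 0 <= m], continuous (fun m => V i t m w)})
  (s : 'I_d -> nat) (Phi : Omega -> \bar R)
  (hPhi : is_ess_sup P (Filt s) (famPhi P Filt beta h' s) Phi) :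
  (exists Y, cond_exp_of P (Filt s)
      (fun w => (\int[lebesgue_measure]_(m in [set m : R | (0 <= m)%R])
                   (1 - epow beta (tau_ms V m s w))%R%:E)%E) Y
    /\ {ae P, forall w, Phi w = Y w})
  /\ (exists Y, cond_exp_of P (Filt s)
      (fun w => (\sum_(t <oo) ((beta ^+ t)%R%:E * N_ts V t s w))%E) Y
    /\ {ae P, forall w, Phi w = ((1 - beta)%:E * Y w)%E})
  /\ (forall T, alloc_strategy Filt s T ->
      ((exists X, cond_exp_of P (Filt s) (reward beta h' T) X
                  /\ {ae P, forall w, X w = Phi w})
       <-> synchronized P V s T)).
Proof.
have b1 : 0 < 1 - beta by rewrite subr_gt0.
pose G := greedy_strategy (Ordinal hd) h' s.
have GA : alloc_strategy Filt s G by apply: greedy_strategy_alloc.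
have Gp w : is_path s (G ^~ w) := alloc_is_path w GA.
have Gg w : greedy (fun i t => h' i t w) (G ^~ w) by apply: greedy_strategy_greedy.
have hdec' w i u : h' i u.+2 w <= h' i u.+1 w by exact: hdec.
have hpos' w i t : (0 < t)%N -> 0 < h' i t w by exact: hpos.
pose v T w := pulled (fun i t => h' i t w) (T ^~ w).
have v_gt0 T w t : alloc_strategy Filt s T -> 0 < v T w t.
  by move=> TA; apply: (pulled_gt0 (hpos' w) t (alloc_is_path w TA)).
have [M vM] : exists M : R, forall w t, v G w t <= M.
  have [M hM] := choice hbdd; exists (\sum_i `|M i|) => w t.
  have [j Gj] := proj2 (Gp w) t; rewrite /v (pulledE _ Gj).
  apply: (@le_trans _ _ (M j)); first exact: hM.
  by apply: le_trans (ler_norm _) _; rewrite (bigD1 j)//= lerDl sumr_ge0.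
have rewardE T w : alloc_strategy Filt s T ->
    reward beta h' T w = discounted beta (v T w).
  by move=> TA; exact: (reward_discounted hb0 (hpos' w) (alloc_is_path w TA)).
have rG_le w : (reward beta h' G w <= (M / (1 - beta))%:E)%E.
  by rewrite rewardE//; apply: discounted_le => // t; apply/ltW/v_gt0.
have r_le T w : alloc_strategy Filt s T ->
    (reward beta h' T w <= reward beta h' G w)%E.
  move=> TA; rewrite !rewardE//; apply: discounted_dom => // t.
  - exact/ltW/v_gt0.
  - exact/ltW/v_gt0.
  - exact: (greedy_opt (hdec' w) (Gp w) (Gg w) t (alloc_is_path w TA)).
have r_ge0 T w : (0 <= reward beta h' T w)%E by exact: (reward_ge0 hb0 (hpos' w)).
have mrG : measurable_fun setT (reward beta h' G).
  rewrite (_ : reward _ _ _ = fun w => discounted beta (v G w)); last first.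
    by apply/funext => w; apply: rewardE.
  apply: (@ge0_emeasurable_sum _ _ _ _ _ xpredT) => [t w _ _|t _].
    by rewrite lee_fin mulr_ge0 ?exprn_ge0// ltW// v_gt0.
  apply/measurable_EFinP; apply: measurable_funM => //.
  exact: (measurable_pulled Fsub F1 hpred t GA).
have rGfin : (\int[P]_w reward beta h' G w < +oo)%E.
  apply: (@le_lt_trans _ _ (\int[P]_w (M / (1 - beta))%:E)%E).
    by apply: ge0_le_integral.
  by rewrite integral_cst//= probability_setT mule1 ltry.
have [Y cY] := cond_exp_exists (Fsig s) (@Fsub s) mrG (r_ge0 G) rGfin.
(* [Y] belongs to the family through [G] and, by pathwise dominance, bounds each member almost
   surely, so it is the essential supremum. *)
have PhiY : {ae P, forall w, Phi w = Y w}.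
  have [mPhi ub lub] := hPhi; have [_ _ mY _ _] := cY.
  have YPhi : {ae P, forall w, (Y w <= Phi w)%E} by apply: ub; exists G.
  have PhiY : {ae P, forall w, (Phi w <= Y w)%E}.
    apply: lub => // X [T [TA cX]].
    by apply: cond_exp_le cX cY _ rGfin => //; apply: aeW => w; apply: r_le.
  by apply: filterS2 YPhi PhiY => w le1 le2; apply/eqP; rewrite eq_le le1 le2.
have VE := V_eq_retire hb0 hb1 Fsig Fsub hpos hdec hbdd hpred hV hVcont.
have intE : {ae P, forall w, reward beta h' G w =
    (\int[lebesgue_measure]_(m in [set m : R | (0 <= m)%R])
       (1 - epow beta (tau_ms V m s w))%R%:E)%E}.
  apply: filterS VE => w VEw; rewrite rewardE//.
  by rewrite (integral_epow hb0 hb1 (hpos' w) (hdec' w) (Gp w) (Gg w) VEw).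
have NE : {ae P, forall w, ((1 - beta)^-1%:E * reward beta h' G w)%E =
    (\sum_(t <oo) ((beta ^+ t)%R%:E * N_ts V t s w))%E}.
  apply: filterS VE => w VEw; rewrite rewardE//.
  by rewrite (discounted_N_ts hb0 hb1 (hpos' w) (hdec' w) (Gp w) (Gg w) VEw).
split; [|split].
- exists Y; split=> //.
  apply: (cond_exp_transfer Pcomplete intE _ (@Fsub s) cY) => w.
  apply: integral_ge0 => m _; rewrite lee_fin subr_ge0.
  by apply: epow_le1 (tau_ms_ge0 _ _ _ _) => //; exact: ltW.
- exists (fun w => ((1 - beta)^-1%:E * Y w)%E); split; last first.
    by apply: filterS PhiY => w ->; rewrite muleA -EFinM divff ?gt_eqF// mul1e.
  have b1V : 0 <= (1 - beta)^-1 by rewrite invr_ge0 ltW.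
  apply: (cond_exp_transfer Pcomplete NE _ (@Fsub s)); last first.
    exact: (cond_exp_scale (Fsig s) (@Fsub s) b1V cY).
  move=> w; apply: nneseries_ge0 => t _ _; apply: mule_ge0; last exact: N_ts_ge0.
  by rewrite lee_fin exprn_ge0// ltW.
move=> T TA; have Tp w := alloc_is_path w TA.
have syncE : {ae P, forall w, (forall (t : nat) (m : R), 0 < m ->
     (\sum_(i < d) mine (((T t w i - s i)%N%:R)%:E)
                        (sigma_idx V i (s i) m w - ((s i)%:R)%:E))%E
     = mine ((t%:R)%:E) (tau_ms V m s w)) <-> (forall t, v T w t = v G w t)}.
  apply: filterS VE => w VEw.
  exact: (sync_pulled_sigma hb1 (hpos' w) (hdec' w) (Gp w) (Gg w) VEw (Tp w)).
split=> [[X [cX XPhi]]|sync].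
- have XY : {ae P, forall w, X w = Y w}.
    by apply: filterS2 XPhi PhiY => w -> ->.
  have mT : measurable_fun setT (reward beta h' T) by have [] := cX.
  have FT : Filt s setT.
    by have [F0 FC _] := Fsig s; rewrite -(setD0 setT); apply: FC.
  (* Equal conditional expectations give equal integrals over [Omega]; with pathwise dominance the
     rewards then agree almost surely, and [discounted_inj] recovers the sequences. *)
  have intTG : (\int[P]_w reward beta h' T w = \int[P]_w reward beta h' G w)%E.
    have [_ _ mX X0 <-//] := cX; have [_ _ mY Y0 <-//] := cY.
    apply: ge0_ae_eq_integral => //.
    + exact: (emeas_wrt_measurable (@Fsub s) mX).
    + exact: (emeas_wrt_measurable (@Fsub s) mY).
    + by apply: filterS XY => w ->.
  have rTG : {ae P, forall w, reward beta h' T w = reward beta h' G w}.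
    apply: le_integral_eq_ae => // w; first exact: r_le.
    exact: le_lt_trans (rG_le w) (ltry _).
  apply: filterS2 syncE rTG => w syncEw; rewrite !rewardE// => rTGw.
  apply/syncEw => t; apply: (discounted_inj hb0 hb1 _ _ (vM w) _ rTGw) => u.
  + exact/ltW/v_gt0.
  + exact/ltW/v_gt0.
  + exact: (greedy_opt (hdec' w) (Gp w) (Gg w) u (Tp w)).
- exists Y; split; last by apply: filterS PhiY => w ->.
  apply: (cond_exp_transfer Pcomplete _ _ (@Fsub s) cY) => //.
  apply: filterS2 syncE sync => w syncEw /syncEw vTG.
  by rewrite !rewardE//; congr discounted; apply/funext => t; rewrite vTG.
Qed.
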